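(* There exists an ideal $\mathcal{I}$ on $\mathbb{N}$ that is an $F_\sigma$ subset of $2^{\mathbb{N}}$ (identifying $\mathcal{P}(\mathbb{N})$ with $2^{\mathbb{N}}$), is not countably generated, and is such that for every family $\{X_A : A\in\mathcal{I}\}$ of compact subsets of $\mathbb{N}^{\mathbb{N}}$ with $X_A\subset X_B$ whenever $A\subset B$ ($A,B\in\mathcal{I}$), one has $\bigcup_{A\in\mathcal{I}}X_A\neq\mathbb{N}^{\mathbb{N}}$.
   Context: An ideal on $\mathbb{N}$ is a family $\mathcal{I}\subset\mathcal{P}(\mathbb{N})$ with $\mathbb{N}\notin\mathcal{I}$, closed under subsets and finite unions; every ideal is assumed to contain the family of all finite subsets of $\mathbb{N}$. $\mathcal{I}$ is countably generated if there is a countable $\beta\subset\mathcal{I}$ such that every $A\in\mathcal{I}$ is contained in some $B\in\beta$. $\mathbb{N}^{\mathbb{N}}$ has the product topology with $\mathbb{N}$ discrete. *)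

(* Defs.v *)
From HB Require Import structures.
From mathcomp Require Import all_boot all_order all_algebra.
From mathcomp Require Import all_classical all_reals all_analysis.

Set Implicit Arguments.
Unset Strict Implicit.
Unset Printing Implicit Defensive.

Local Open Scope classical_set_scope.

(** [ideal_finite] also gives that the empty set belongs to [I], so closure
    under binary unions amounts to closure under all finite unions. *)
Record ideal (I : set (set nat)) : Prop := Ideal {
  ideal_proper : ~ I [set: nat];
  ideal_subset : forall A B : set nat, A `<=` B -> I B -> I A;
  ideal_setU : forall A B : set nat, I A -> I B -> I (A `|` B);
  ideal_finite : forall A : set nat, finite_set A -> I A
}.

Definition countably_generated (I : set (set nat)) : Prop :=
  exists beta : set (set nat),
    [/\ countable beta, beta `<=` I &
        forall A, I A -> exists2 B, beta B & A `<=` B].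

Definition char_seq (A : set nat) : cantor_space := fun n => n \in A.

(** The library's topology on [nat] is the discrete one. *)
Definition baire_space : Type := prod_topology (fun _ : nat => nat).

HB.instance Definition _ := Pointed.on baire_space.
HB.instance Definition _ := Nbhs.on baire_space.
HB.instance Definition _ := Topological.on baire_space.
HB.instance Definition _ := Uniform.on baire_space.

(* Main.v *)
Require Import Defs.
From mathcomp Require Import all_boot all_order all_algebra.
From mathcomp Require Import all_classical all_reals all_analysis.
From mathcomp Require Import borel_hierarchy.
From mathcomp Require Import zify.

Local Open Scope classical_set_scope.

(** Cut [nat] into the blocks [2^n, 2^(n+1)) and let [I] consist of the sets
    whose trace on the n-th block has size polynomial in n.  It is the union
    of the closed sets [C_c] given by the bounds [(n + 2)^c].

    A union of n + 1 sets of size [(n + 2)^c] has size at most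
    [(n + 2)^(c + 1)].  So if a sequence in [C_c] is thinned out until all its
    members from the l-th on agree up to the l-th block, which is possible by
    compactness of the Cantor space, then its union belongs to [C_(c + 1)].

    Suppose the monotone family X covers the Baire space, and attach to each x
    some [A_x] in [I] with x in [X_(A_x)].  Diagonally, for some c every k is
    the value [x_k c] of some [x_k] with [A_(x_k)] in [C_c].  Infinitely many
    of the [A_(x_k)] lie in a single B in [I], so infinitely many of the [x_k]
    lie in the compact set [X_B], which bounds their c-th coordinates. *)

Definition block n : seq nat := iota (2 ^ n) (2 ^ n).

(** The base [n + 2] is at least 2, so the bounds grow with [c], and raising [c] by one absorbs a
    factor 2. *)
Definition poly_bounded c : set (set nat) :=
  [set A | forall n, count (char_seq A) (block n) <= (n + 2) ^ c].

Definition poly_ideal : set (set nat) := \bigcup_c poly_bounded c.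

Lemma mem_block m n : (m \in block n) = (2 ^ n <= m < 2 ^ n.+1).
Proof. by rewrite mem_iota expnS mul2n addnn. Qed.

Lemma mem_blockE m n : m \in block n -> trunc_log 2 m = n.
Proof. by rewrite mem_block => /trunc_log_eq ->. Qed.

Lemma mem_char_seq (A : set nat) m : char_seq A m = (m \in A).
Proof. by []. Qed.

Lemma count_bigcup_le (A : set nat) (B : nat -> set nat) s N M :
  (forall m, m \in s -> A m -> exists2 k, k < N & B k m) ->
  (forall k, k < N -> count (char_seq (B k)) s <= M) ->
  count (char_seq A) s <= N * M.
Proof.
move=> AB BM.
have -> : N * M = \sum_(k < N) M by rewrite sum_nat_const card_ord.
apply: (@leq_trans (\sum_(k < N) count (char_seq (B k)) s)); last first.
  by apply: leq_sum => k _; exact: BM.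
rewrite -sum1_count big_mkcond /=.
under [leqRHS]eq_bigr do rewrite -sum1_count big_mkcond /=.
rewrite exchange_big /= big_seq [leqRHS]big_seq; apply: leq_sum => m ms.
case: ifP => //; rewrite mem_char_seq inE => /(AB _ ms)[k kN Bkm].
rewrite (bigD1 (Ordinal kN)) //= mem_char_seq.
by rewrite (mem_set Bkm).
Qed.

Lemma poly_lt_exp c k : exists2 n, k <= n & (n + 2) ^ c < 2 ^ n.
Proof.
pose j := (c + k + 5)%N.
have sqr_lt i : (i + 5) * (i + 5) + 2 < 2 ^ (i + 5).
  elim: i => [//|i]; rewrite addSn expnS; lia.
have := sqr_lt (c + k)%N; rewrite -/j => jlt.
have j_lt : j < 2 ^ j by exact: ltn_expl.
(* With [n + 2 = 2 ^ j] the claim becomes [j * c < 2 ^ j - 2], which follows from [jlt] as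
   [c <= j]. *)
exists (2 ^ j - 2)%N; first by rewrite /j in jlt *; nia.
rewrite subnK; last by lia.
rewrite -expnM ltn_exp2l //.
have : j * c <= j * j by rewrite leq_mul2l /j; lia.
lia.
Qed.

Lemma poly_bounded_le c d A : c <= d -> poly_bounded c A -> poly_bounded d A.
Proof.
move=> cd cA n; apply: leq_trans (cA n) _.
by rewrite leq_pexp2l// addn2.
Qed.

Lemma poly_bounded_sub c (A B : set nat) :
  A `<=` B -> poly_bounded c B -> poly_bounded c A.
Proof.
move=> AB cB n; apply: leq_trans (cB n); apply: sub_count => m.
by rewrite !mem_char_seq !inE => /AB.
Qed.

Lemma poly_ideal_ideal : ideal poly_ideal.
Proof.
split.
- move=> [c _ cT]; have [n _] := poly_lt_exp c 0.
  rewrite ltnNge => /negP; apply.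
  have := cT n.
  rewrite (@eq_count _ _ predT) ?count_predT ?size_iota// => m.
  by rewrite mem_char_seq in_setT.
- by move=> A B AB [c _ cB]; exists c => //; exact: poly_bounded_sub AB cB.
- move=> A B [c _ cA] [d _ dB]; exists (maxn c d).+1 => // n.
  rewrite expnS.
  apply: (@leq_trans (2 * (n + 2) ^ maxn c d)); last first.
    by rewrite leq_mul2r leq_addl orbT.
  apply: (count_bigcup_le _ (fun k => if k is 0 then A else B)).
    by move=> m _ [Am|Bm]; [exists 0|exists 1].
  move=> [|k] _; apply: poly_bounded_le n.
  + exact: leq_maxl.
  + exact: cA.
  + exact: leq_maxr.
  + exact: dB.
- move=> A /finite_seqP[s As].
  have [N AN] : exists N, forall m, A m -> m < N.
    exists (\max_(i <- s) i).+1 => m; rewrite As /= => ms.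
    by rewrite ltnS; exact: leq_bigmax_seq.
  (* A block with [2 ^ n <= N] has at most [N < 2 ^ N <= (n + 2) ^ N] points; later blocks miss
     [A]. *)
  exists N => // n.
  have [nN|Nn] := leqP (2 ^ n) N.
    apply: (leq_trans (count_size _ _)); rewrite size_iota.
    apply: (leq_trans nN); apply: (leq_trans (ltnW (ltn_expl N (leqnn 2)))).
    by case: N {AN nN} => // N; rewrite leq_exp2r// leq_addl.
  rewrite (@eq_in_count _ _ pred0) ?count_pred0// => m.
  rewrite mem_block mem_char_seq => /andP[nm _]; apply/negbTE.
  by rewrite notin_setE => /AN; lia.
Qed.

Lemma nbhs_cylinder (T : nat -> pdiscreteTopologicalType)
    (y : prod_topology T) N :
  nbhs y [set z : prod_topology T | forall i, i < N -> z i = y i].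
Proof.
elim: N => [|N IH]; first by apply: filterS filterT => z _ i.
have yN : nbhs y (proj N @^-1` [set y N] : set (prod_topology T)).
  by apply: (@proj_continuous _ T N y); apply: discrete_set1.
apply: filterS2 IH yN => z zy /= zN i.
rewrite ltnS leq_eqVlt => /orP[/eqP ->|]; first exact: zN.
exact: zy.
Qed.

(** Each [poly_bounded c] is closed: whether the bound fails on block [n] depends only on
    coordinates below [2 ^ n.+1]. *)
Lemma Fsigma_poly_ideal : Fsigma (char_seq @` poly_ideal : set cantor_space).
Proof.
exists (fun c => char_seq @` poly_bounded c).
  move=> c; rewrite -[X in closed X]setCK; apply: open_closedC.
  rewrite openE => y /= yc.
  have [n yn] : exists n, ~~ (count y (block n) <= (n + 2) ^ c).
    apply: contrapT => /forallNP yn; apply: yc.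
    exists [set m | y m].
      move=> n; have /negP := yn n; rewrite negbK; apply: leq_trans.
      by apply: sub_count => m; rewrite mem_char_seq inE.
    by apply/funext => m; apply/idP/idP; rewrite mem_char_seq inE.
  have := nbhs_cylinder (fun=> bool : pdiscreteTopologicalType) y (2 ^ n.+1).
  apply: filterS => z zy [A cA Az].
  move/negP : yn; apply; rewrite (@eq_in_count _ _ (char_seq A)); first exact: cA.
  by move=> m; rewrite mem_block Az => /andP[_ /zy].
rewrite /poly_ideal image_bigcup //.
Qed.

(** Diagonalization: from block [n], [A] takes a point outside each generator of index at most [n],
    if there is one. No generator contains [A], since some block beyond its index is too large for
    it to fill. *)
Lemma poly_ideal_not_countably_generated : ~ countably_generated poly_ideal.
Proof.
move=> [beta [/countable_injP[h hinj] betaI gen]].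
pose Bk k := xget set0 [set B | beta B /\ h B = k].
(* The default 0, used when [Bk k] contains block [n], lies in no block. *)
pose g n k := xget 0 [set m | m \in block n /\ ~ Bk k m].
pose A := [set m | exists2 k, k < (trunc_log 2 m).+1 & m = g (trunc_log 2 m) k].
have [] := gen A.
  exists 1 => // n.
  rewrite expn1 (@leq_trans (n.+1 * 1)) ?muln1 ?addn2//.
  rewrite -(muln1 n.+1).
  apply: (count_bigcup_le _ (fun k => [set g n k])).
    by move=> m /mem_blockE mn; rewrite /A /= mn.
  move=> k _; rewrite (@eq_count _ _ (pred1 (g n k))).
    by rewrite count_uniq_mem ?iota_uniq// leq_b1.
  by move=> m; rewrite mem_char_seq /=; apply/idP/eqP; rewrite inE.
move=> B betaB AB; have [c _ cB] := betaI _ betaB.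
have BkB : Bk (h B) = B.
  rewrite /Bk; case: xgetP => [B' _ [betaB' hB']|/(_ B)]; last by case.
  by apply: hinj; rewrite ?inE.
have [n hn cn] := poly_lt_exp c (h B).
have [m [mn nBm]] : exists m, m \in block n /\ ~ Bk (h B) m.
  apply: contrapT => /forallNP nB.
  move: cn; rewrite ltnNge => /negP; apply; apply: leq_trans (cB n).
  rewrite (@eq_in_count _ _ predT) ?count_predT ?size_iota// => m mn.
  rewrite mem_char_seq; apply/mem_set; apply: contrapT => Bm.
  by apply: (nB m); rewrite BkB.
have [gn ngB] : g n (h B) \in block n /\ ~ Bk (h B) (g n (h B)).
  exact: (@xgetI _ 0 [set m | m \in block n /\ ~ Bk (h B) m] m).
apply: ngB; rewrite BkB; apply: AB.
by exists (h B); rewrite (mem_blockE _ _ gn).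
Qed.

Lemma poly_bounded_subsequence c (A : nat -> set nat) :
  (forall k, poly_bounded c (A k)) ->
  exists2 f : nat -> nat, (forall l, l <= f l) &
    poly_bounded c.+1 (\bigcup_l A (f l)).
Proof.
move=> cA.
have [L [_ clL]] : [set: cantor_space] `&`
    cluster ((fun k => char_seq (A k)) @ \oo) !=set0.
  by apply: cantor_space_compact; exact: filterT.
have sub l : exists k, l <= k /\
    forall m, m < 2 ^ l.+1 -> char_seq (A k) m = L m.
  have [] := clL [set char_seq (A k) | k in [set k | l <= k]] _ _
    (nbhs_cylinder (fun=> bool : pdiscreteTopologicalType) L (2 ^ l.+1)).
    by exists l => // k lk; exists k.
  by move=> _ [[k lk <-] kL]; exists k.
have {sub} [f fP] := choice sub.
exists f; first by move=> l; exact: (fP l).1.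
move=> n; apply: (@leq_trans (n.+1 * (n + 2) ^ c)); last first.
  by rewrite expnS leq_mul2r addn2 leqnSn orbT.
apply: (count_bigcup_le _ (A \o f)); last by move=> k _; exact: cA.
move=> m; rewrite mem_block => /andP[_ mn] [l _ Alm].
have [ln|nl] := leqP l n; first by exists l.
(* For [l > n], both [A (f l)] and [A (f n)] agree with [L] on block [n], so [n] can replace [l]. *)
exists n => //=; apply/set_mem.
rewrite -[_ \in _]/(char_seq (A (f n)) m) (fP n).2// -(fP l).2.
  exact/mem_set.
by rewrite (leq_trans mn)// leq_exp2l// ltnW.
Qed.

(** The [n]-th coordinate is locally constant, so a bound valid at a point is valid near it;
    compactness makes it uniform. *)
Lemma compact_baire_bounded (K : set baire_space) n :
  compact K -> exists M, forall x, K x -> x n < M.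
Proof.
move=> /compact_near_coveringP/(_ nat \oo (fun M x => x n < M) _).
case=> [x _|M _ KM]; last by exists M => x; apply: (KM M) => /=.
exists ([set z | forall i, i < n.+1 -> z i = x i], [set M | x n < M]).
  split; last by exists (x n).+1.
  exact: (nbhs_cylinder (fun=> nat : pdiscreteTopologicalType) x n.+1).
by move=> [z M] [/= zx]; rewrite zx.
Qed.

(** If every [c] had a value missed by the [c]-th coordinate on [D c], the sequence of these values
    would lie in no [D c]. *)
Lemma countable_cover_full_coordinate (D : nat -> set baire_space) :
  \bigcup_c D c = setT -> exists c, forall k, exists2 x, D c x & x c = k.
Proof.
move=> DT; apply: contrapT => /forallNP nD.
have {}nD c : exists k, ~ exists2 x, D c x & x c = k.
  exact/existsNP/nD.
have [x xD] := choice nD.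
have [c _ Dx] : (\bigcup_c D c) x by rewrite DT.
by case: (xD c); exists x.
Qed.

Lemma poly_ideal_no_monotone_compact_cover (X : set nat -> set baire_space) :
  (forall A, poly_ideal A -> compact (X A)) ->
  (forall A B, poly_ideal A -> poly_ideal B -> A `<=` B -> X A `<=` X B) ->
  \bigcup_(A in poly_ideal) X A <> [set: baire_space].
Proof.
move=> Xcompact Xmono XT.
have [c cP] : exists c, forall k, exists2 x,
    (\bigcup_(A in poly_bounded c) X A) x & x c = k.
  apply: countable_cover_full_coordinate.
  rewrite -subTset -XT => x [A [c _ cA] XAx].
  by exists c => //; exists A.
have {}cP k : exists A, poly_bounded c A /\ exists2 x, X A x & x c = k.
  by have [x [A cA XAx] xk] := cP k; exists A; split => //; exists x.
have {cP} [A AP] := choice cP.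
have [f lf cB] := poly_bounded_subsequence c A (fun k => (AP k).1).
set B := \bigcup_l A (f l) in cB.
have IB : poly_ideal B by exists c.+1.
have [M XM] := compact_baire_bounded _ c (Xcompact _ IB).
(* This point of [X B] has [c]-th coordinate [f M >= M], against the bound. *)
have [cA [x XAx xc]] := AP (f M).
have : x c < M.
  apply: XM; apply: Xmono XAx => //; first by exists c.
  exact: bigcup_sup.
by rewrite xc ltnNge lf.
Qed.

(* The family {X_A : A in I} is represented by a function X on all subsets of
   nat; nothing is assumed about X A when A is not in I. *)
Theorem mainTheorem8 :
  exists I : set (set nat),
    [/\ ideal I,
        Fsigma (char_seq @` I : set cantor_space),
        ~ countably_generated I &
        forall X : set nat -> set baire_space,
          (forall A, I A -> compact (X A)) ->
          (forall A B, I A -> I B -> A `<=` B -> X A `<=` X B) ->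
          \bigcup_(A in I) X A <> [set: baire_space]].
Proof.
exists poly_ideal; split.
- exact: poly_ideal_ideal.
- exact: Fsigma_poly_ideal.
- exact: poly_ideal_not_countably_generated.
- exact: poly_ideal_no_monotone_compact_cover.
Qed.
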